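(* Let $\Bbbk$ be an algebraically closed field of characteristic zero and let $\mathcal{K}$ be the $8$-dimensional non-semisimple non-pointed Hopf algebra over $\Bbbk$ described in the context (with $q$ and $\sqrt2$ as there). The partial coactions of $\mathcal{K}$ on $\Bbbk$ are exactly the maps $\Bbbk\to\Bbbk\otimes\mathcal{K}$, $1\mapsto1\otimes e$, where $e$ is one of the following elements of $\mathcal{K}$: (1) $e=1$; (2) $e=\frac12(1+a^2)+\alpha q\frac{\sqrt2}{2}\,ac$, with $\alpha\in\Bbbk$; (3) $e=\frac14(1+a+a^2+d)+\zeta\frac{\sqrt2}{8}\left((1+q)b-(1-q)c+2q\,ac\right)$, with $\zeta\in\{q,-q\}$.
   Context: A (right) partial coaction of a Hopf algebra $H$ on an algebra $A$ is a linear map $\rho:A\to A\otimes H$ such that for all $a',b'\in A$: (i) $(A\otimes\varepsilon)\rho(a')=a'$; (ii) $\rho(a'b')=\rho(a')\rho(b')$; (iii) $(\rho\otimes H)\rho(a')=(\rho(1_A)\otimes 1_H)\,(A\otimes\Delta)\rho(a')$. Here it is used with $A=\Bbbk$. Let $\xi\in\Bbbk$ be a primitive eighth root of unity, $q:=\xi^2$, $\sqrt2:=\frac{2\xi}{1+\xi^2}$. The Hopf algebra $\mathcal{K}$ is generated as an algebra by $a,b,c,d$ with relations $a^4=ad=da=1$, $b^2=c^2=bc=cb=0$, $a^2c=b$, $ab=q\,ba$, $ac=q\,ca$, $bd=q\,db$, $cd=q\,dc$. It has linear basis $\{1,a,b,c,d,a^2,ab,ac\}$. Coproduct: $\Delta(1)=1\otimes1$,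 $\Delta(a^2)=a^2\otimes a^2$, $\Delta(a)=a\otimes a+b\otimes c$, $\Delta(b)=b\otimes d+a\otimes b$, $\Delta(c)=c\otimes a+d\otimes c$, $\Delta(d)=c\otimes b+d\otimes d$, $\Delta(ab)=ab\otimes1+a^2\otimes ab$, $\Delta(ac)=ac\otimes a^2+1\otimes ac$. Counit: $\varepsilon(1)=\varepsilon(a)=\varepsilon(a^2)=\varepsilon(d)=1$, $\varepsilon(b)=\varepsilon(c)=\varepsilon(ab)=\varepsilon(ac)=0$. Antipode: $S(a)=d$, $S(b)=qb$, $S(c)=-qc$, $S(d)=a$. *)

(* Defs.v *)
From HB Require Import structures.
From mathcomp Require Import all_boot all_order all_algebra all_field.

Set Implicit Arguments.
Unset Strict Implicit.
Unset Printing Implicit Defensive.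

Import GRing.Theory.
Local Open Scope ring_scope.

(* Tensor product of finite-dimensional vector spaces, in coordinates with    *)
(* respect to the bases vbasis fullv; tlift_ten and tlift_uniq show that it   *)
(* has the universal property of the tensor product.                          *)
Definition tensor (k : fieldType) (U V : vectType k) :=
  'M[k]_(\dim {:U}, \dim {:V}).

HB.instance Definition _ (k : fieldType) (U V : vectType k) :=
  Vector.on (tensor U V).

Section Tensor.
Context {k : fieldType} {U V : vectType k}.

Definition ten (u : U) (v : V) : tensor U V :=
  \matrix_(i, j) (coord (vbasis {:U}) i u * coord (vbasis {:V}) j v).

(* The linear map induced on tensor U V by a bilinear map B.                  *)
Definition tlift (W : lmodType k) (B : U -> V -> W) (X : tensor U V) : W :=
  \sum_i \sum_j X i j *: B (vbasis {:U})`_i (vbasis {:V})`_j.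

End Tensor.

Notation "u ⊗ v" := (ten u v) (at level 40, left associativity) : ring_scope.

Section TensorTheory.
Variable k : fieldType.
Implicit Types U V W : vectType k.

Lemma tenDl U V (u u' : U) (v : V) : (u + u') ⊗ v = u ⊗ v + u' ⊗ v.
Proof. by apply/matrixP=> i j; rewrite !mxE linearD mulrDl. Qed.

Lemma tenDr U V (u : U) (v v' : V) : u ⊗ (v + v') = u ⊗ v + u ⊗ v'.
Proof. by apply/matrixP=> i j; rewrite !mxE linearD mulrDr. Qed.

Lemma tenZl U V c (u : U) (v : V) : (c *: u) ⊗ v = c *: (u ⊗ v).
Proof. by apply/matrixP=> i j; rewrite !mxE linearZ /= mulrA. Qed.

Lemma tenZr U V c (u : U) (v : V) : u ⊗ (c *: v) = c *: (u ⊗ v).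
Proof. by apply/matrixP=> i j; rewrite !mxE linearZ /= mulrCA. Qed.

Lemma ten_vbasis U V (i : 'I_(\dim {:U})) (j : 'I_(\dim {:V})) :
  (vbasis {:U})`_i ⊗ (vbasis {:V})`_j = delta_mx i j :> tensor U V.
Proof.
apply/matrixP=> i' j'; rewrite !mxE !coord_free ?(basis_free (vbasisP _)) //.
by rewrite -natrM mulnb (eq_sym i) (eq_sym j).
Qed.

Lemma ten_expand U V (X : tensor U V) :
  X = \sum_i \sum_j X i j *: ((vbasis {:U})`_i ⊗ (vbasis {:V})`_j).
Proof.
rewrite {1}[X]matrix_sum_delta.
by do 2!apply: eq_bigr => ? _; rewrite ten_vbasis.
Qed.

Lemma ten_ind U V (P : tensor U V -> Prop) :
    (forall u v, P (u ⊗ v)) -> (forall X Y, P X -> P Y -> P (X + Y)) ->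
  forall X, P X.
Proof.
move=> Pt PD X; rewrite (ten_expand X).
have P0 : P 0 by rewrite -(scale0r (0 ⊗ 0)) -tenZl.
apply: (big_ind P) => // i _; apply: (big_ind P) => // j _.
by rewrite -tenZl.
Qed.

Lemma tlift_is_linear U V (W : lmodType k) (B : U -> V -> W) :
  linear (tlift B).
Proof.
move=> c X Y; rewrite /tlift scaler_sumr -big_split; apply: eq_bigr => i _.
rewrite scaler_sumr -big_split; apply: eq_bigr => j _.
by rewrite !mxE scalerDl scalerA.
Qed.

HB.instance Definition _ U V (W : lmodType k) (B : U -> V -> W) :=
  GRing.isLinear.Build k (tensor U V) W _ (tlift B) (tlift_is_linear B).

Lemma tlift_ten U V (W : lmodType k) (B : U -> V -> W) u v :
  bilinear_for *:%R *:%R B -> tlift B (u ⊗ v) = B u v.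
Proof.
case=> Bl Br.
pose L v : {linear U -> W} := HB.pack (B^~ v) (GRing.isLinear.Build _ _ _ _ _ (Bl v)).
pose R u : {linear V -> W} := HB.pack (B u) (GRing.isLinear.Build _ _ _ _ _ (Br u)).
rewrite {2}(coord_vbasis (memvf u)) -[B _ v]/(L v _) linear_sum.
apply: eq_bigr => i _; rewrite linearZ /= {2}(coord_vbasis (memvf v)).
rewrite -[B _ _]/(R _ _) linear_sum scaler_sumr; apply: eq_bigr => j _.
by rewrite linearZ /= mxE scalerA.
Qed.

Lemma tlift_uniq U V (W : lmodType k) (f g : {linear tensor U V -> W}) :
  (forall u v, f (u ⊗ v) = g (u ⊗ v)) -> f =1 g.
Proof. by move=> fg; apply: ten_ind => // X Y fX fY; rewrite !linearD fX fY. Qed.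

End TensorTheory.

Section TensorAlgebra.
Context {k : fieldType} {A B : falgType k}.
Implicit Types X Y Z : tensor A B.

Definition tmul X Y : tensor A B :=
  tlift (fun a b => tlift (fun a' b' => (a * a') ⊗ (b * b')) Y) X.

Let tmulDl : left_distributive tmul +%R.
Proof. by move=> X Y Z; rewrite /tmul linearD. Qed.

Let tmulDr : right_distributive tmul +%R.
Proof.
move=> X Y Z; rewrite {1}/tmul; set F := fun a b => tlift _ _.
have FD a b : F a b = tlift (fun a' b' => (a * a') ⊗ (b * b')) Y
    + tlift (fun a' b' => (a * a') ⊗ (b * b')) Z by rewrite /F linearD.
rewrite /tmul /tlift -big_split; apply: eq_bigr => i _.
by rewrite -big_split; apply: eq_bigr => j _; rewrite FD scalerDr.
Qed.

Let tmul_ten a b a' b' : tmul (a ⊗ b) (a' ⊗ b') = (a * a') ⊗ (b * b').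
Proof.
have Bl (x : A) (y : B) : bilinear_for *:%R *:%R
    (fun x' y' => (x * x') ⊗ (y * y') : tensor A B).
  split=> ? c ? ?; first by rewrite mulrDr -scalerAr tenDl tenZl.
  by rewrite mulrDr -scalerAr tenDr tenZr.
rewrite /tmul tlift_ten ?tlift_ten //; split=> ? c x y /=; rewrite !tlift_ten //.
  by rewrite mulrDl -scalerAl tenDl tenZl.
by rewrite mulrDl -scalerAl tenDr tenZr.
Qed.

Let tmulA : associative tmul.
Proof.
elim/ten_ind=> [a b|X X' eX eX' Y Z]; last by rewrite !tmulDl eX eX'.
elim/ten_ind=> [a' b'|Y Y' eY eY' Z]; last by rewrite !(tmulDl, tmulDr) eY eY'.
elim/ten_ind=> [a'' b''|Z Z' eZ eZ']; last by rewrite !tmulDr eZ eZ'.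
by rewrite !tmul_ten !mulrA.
Qed.

Let tmul1r : left_id (1 ⊗ 1) tmul.
Proof.
elim/ten_ind=> [a b|X Y eX eY]; first by rewrite tmul_ten !mul1r.
by rewrite tmulDr eX eY.
Qed.

Let tmulr1 : right_id (1 ⊗ 1) tmul.
Proof.
elim/ten_ind=> [a b|X Y eX eY]; first by rewrite tmul_ten !mulr1.
by rewrite tmulDl eX eY.
Qed.

Let toner_neq0 : 1 ⊗ 1 != 0 :> tensor A B.
Proof.
have ex1 (C : falgType k) : exists i, coord (vbasis {:C}) i 1 != 0.
  apply/existsP; apply: contraT; rewrite negb_exists => /forallP z1.
  have /negP[] := oner_neq0 C; apply/eqP.
  rewrite (coord_vbasis (memvf 1)) big1 // => i _.
  by move: (z1 i); rewrite negbK => /eqP ->; rewrite scale0r.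
have [[i i1] [j j1]] := (ex1 A, ex1 B).
by apply/eqP => /matrixP/(_ i j)/eqP; rewrite !mxE mulf_eq0 (negPf i1) (negPf j1).
Qed.

HB.instance Definition _ := GRing.Zmodule_isNzRing.Build (tensor A B)
  tmulA tmul1r tmulr1 tmulDl tmulDr toner_neq0.

Let tmulZl (c : k) X Y : c *: (X * Y) = (c *: X) * Y.
Proof. by rewrite /GRing.mul /= /tmul linearZ. Qed.

HB.instance Definition _ :=
  GRing.Lmodule_isLalgebra.Build k (tensor A B) tmulZl.

Let tmulZr (c : k) X Y : c *: (X * Y) = X * (c *: Y).
Proof.
elim/ten_ind: X => [a b|X X' eX eX']; last by rewrite !mulrDl scalerDr eX eX'.
elim/ten_ind: Y => [a' b'|Y Y' eY eY']; last by rewrite !(mulrDr, scalerDr) eY eY'.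
by rewrite /GRing.mul /= -tenZl !tmul_ten -scalerAr tenZl.
Qed.

HB.instance Definition _ :=
  GRing.Lalgebra_isAlgebra.Build k (tensor A B) tmulZr.
HB.instance Definition _ := Algebra_isFalgebra.Build k (tensor A B).

Lemma mul_ten (a a' : A) (b b' : B) :
  (a ⊗ b) * (a' ⊗ b') = (a * a') ⊗ (b * b').
Proof. exact: tmul_ten. Qed.

Lemma one_ten : 1 = 1 ⊗ 1 :> tensor A B.
Proof. by []. Qed.

End TensorAlgebra.

(* Maps between tensor products; each is only meaningful for linear arguments. *)
Section TensorMaps.
Context {k : fieldType}.
Implicit Types U V W : vectType k.

Definition tmap U V U' V' (f : U -> U') (g : V -> V') :
  tensor U V -> tensor U' V' := tlift (fun u v => f u ⊗ g v).

(* The canonical isomorphisms that are left implicit on paper.                *)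
Definition tassoc U V W : tensor U (tensor V W) -> tensor (tensor U V) W :=
  tlift (fun u => tlift (fun v w => u ⊗ v ⊗ w)).

Definition tunitl V : tensor k^o V -> V := tlift (fun (c : k^o) v => (c : k) *: v).

Definition tunitr U : tensor U k^o -> U := tlift (fun u (c : k^o) => (c : k) *: u).

End TensorMaps.

Record hopfAlg (k : fieldType) (H : falgType k) := HopfAlg {
  comul : {linear H -> tensor H H};
  counit : {linear H -> k^o};
  antipode : {linear H -> H};
  comulA : forall x,
    tassoc (tmap id comul (comul x)) = tmap comul id (comul x);
  counitl : forall x, tunitl (tmap counit id (comul x)) = x;
  counitr : forall x, tunitr (tmap id counit (comul x)) = x;
  comul1 : comul 1 = 1;
  comulM : {morph comul : x y / x * y};
  counit1 : counit 1 = 1;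
  counitM : {morph counit : x y / x * y};
  antipodel : forall x,
    tlift (@GRing.mul H) (tmap antipode id (comul x)) = (counit x : k)%:A;
  antipoder : forall x,
    tlift (@GRing.mul H) (tmap id antipode (comul x)) = (counit x : k)%:A
}.

Definition partial_coaction (k : fieldType) (H A : falgType k)
    (hH : hopfAlg H) (rho : A -> tensor A H) : Prop :=
  [/\ linear rho,
      forall a, tunitr (tmap id (counit hH) (rho a)) = a,
      {morph rho : a b / a * b}
    & forall a, tmap rho id (rho a) =
        (rho 1 ⊗ 1) * tassoc (tmap id (comul hH) (rho a))].

(* K, with Hopf algebra structure hK, is the 8-dimensional Hopf algebra with  *)
(* generators a, b, c, d.  The vectors in K8_basis are monomials in the       *)
(* generators, so the relations give a presentation of the algebra K.         *)
Record isK8 (k : fieldType) (q : k) (K : falgType k) (hK : hopfAlg K)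
    (a b c d : K) : Prop := IsK8 {
  K8_a4 : a ^+ 4 = 1;
  K8_ad : a * d = 1;
  K8_da : d * a = 1;
  K8_bb : b ^+ 2 = 0;
  K8_cc : c ^+ 2 = 0;
  K8_bc : b * c = 0;
  K8_cb : c * b = 0;
  K8_aac : a ^+ 2 * c = b;
  K8_ab : a * b = q *: (b * a);
  K8_ac : a * c = q *: (c * a);
  K8_bd : b * d = q *: (d * b);
  K8_cd : c * d = q *: (d * c);
  K8_basis : basis_of {:K} [:: 1; a; b; c; d; a ^+ 2; a * b; a * c];
  K8_comul1 : comul hK 1 = 1 ⊗ 1;
  K8_comulaa : comul hK (a ^+ 2) = a ^+ 2 ⊗ (a ^+ 2);
  K8_comula : comul hK a = a ⊗ a + b ⊗ c;
  K8_comulb : comul hK b = b ⊗ d + a ⊗ b;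
  K8_comulc : comul hK c = c ⊗ a + d ⊗ c;
  K8_comuld : comul hK d = c ⊗ b + d ⊗ d;
  K8_comulab : comul hK (a * b) = (a * b) ⊗ 1 + a ^+ 2 ⊗ (a * b);
  K8_comulac : comul hK (a * c) = (a * c) ⊗ (a ^+ 2) + 1 ⊗ (a * c);
  K8_counit1 : counit hK 1 = 1;
  K8_counita : counit hK a = 1;
  K8_counitaa : counit hK (a ^+ 2) = 1;
  K8_counitd : counit hK d = 1;
  K8_counitb : counit hK b = 0;
  K8_counitc : counit hK c = 0;
  K8_counitab : counit hK (a * b) = 0;
  K8_counitac : counit hK (a * c) = 0;
  K8_antipodea : antipode hK a = d;
  K8_antipodeb : antipode hK b = q *: b;
  K8_antipodec : antipode hK c = - q *: c;
  K8_antipoded : antipode hK d = a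
}.

(* Main.v *)
(** A partial coaction on the base field is given by e with rho(1) = 1 ⊗ e: the
    axioms say eps(e) = 1 and (e ⊗ 1) Delta(e) = e ⊗ e, and applying id ⊗ eps to
    the latter shows that e is idempotent.  Comparing the coefficients of the right
    tensor factors over the basis of K turns this into eight equations on right
    multiples of e.  Modulo the radical they force e to be the normalised sum over
    a subgroup of <a>; the subgroups 1, <a^2> and <a> give the three families, and
    the remaining equations fix the nilpotent part of e. *)
Require Import Defs.
From HB Require Import structures.
From mathcomp Require Import all_boot all_order all_algebra all_field.
From mathcomp Require Import ring.

Set Implicit Arguments.
Unset Strict Implicit.
Unset Printing Implicit Defensive.

Import GRing.Theory.
Local Open Scope ring_scope.

(** * Linearity of the tensor maps and their values on pure tensors *)

Section TensorMapTheory.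
Variable k : fieldType.
Implicit Types U V W : vectType k.

HB.instance Definition _ U V (U' V' : vectType k) (f : U -> U') (g : V -> V') :=
  GRing.Linear.copy (tmap f g) (tlift (fun u v => f u ⊗ g v)).
HB.instance Definition _ U V W :=
  GRing.Linear.copy (@tassoc k U V W) (tlift (fun u => tlift (fun v w => u ⊗ v ⊗ w))).
HB.instance Definition _ V :=
  GRing.Linear.copy (@tunitl k V) (tlift (fun (c : k^o) v => (c : k) *: v)).
HB.instance Definition _ U :=
  GRing.Linear.copy (@tunitr k U) (tlift (fun u (c : k^o) => (c : k) *: u)).

(** Functionals separate vectors. This turns an identity between vectors into one between scalars,
    where [ring] applies with the values of [f] as atoms. *)
Lemma scalar_ext V (v w : V) : (forall f : {scalar V}, f v = f w) -> v = w.
Proof.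
move=> fvw; rewrite (coord_vbasis (memvf v)) (coord_vbasis (memvf w)).
by apply: eq_bigr => i _; rewrite fvw.
Qed.

Lemma tmap_ten U V (U' V' : vectType k) (f : {linear U -> U'})
    (g : {linear V -> V'}) u v : tmap f g (u ⊗ v) = f u ⊗ g v.
Proof.
rewrite /tmap tlift_ten //; split=> ? z ? ?.
  by rewrite linearP tenDl tenZl.
by rewrite linearP tenDr tenZr.
Qed.

(** Stated with a product in [k], to which the action of [k] on [k^o] unfolds; with the next lemma
    it gives the bilinearity of scaling. *)
Lemma scale_leftP V (z s t : k) (v : V) :
  (z * s + t) *: v = z *: (s *: v) + t *: v.
Proof. by rewrite scalerDl scalerA. Qed.

Lemma scale_rightP V (t z : k) (v w : V) :
  t *: (z *: v + w) = z *: (t *: v) + t *: w.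
Proof. by rewrite scalerDr !scalerA mulrC. Qed.

Lemma tunitl_ten V (t : k^o) (v : V) : tunitl (t ⊗ v) = (t : k) *: v.
Proof.
rewrite /tunitl tlift_ten //.
by split=> ? ? ? ?; [apply: scale_leftP | apply: scale_rightP].
Qed.

Lemma tunitr_ten U (u : U) (t : k^o) : tunitr (u ⊗ t) = (t : k) *: u.
Proof.
rewrite /tunitr tlift_ten //.
by split=> ? ? ? ?; [apply: scale_rightP | apply: scale_leftP].
Qed.

Lemma tassoc_ten U V W (u : U) (v : V) (w : W) :
  tassoc (u ⊗ (v ⊗ w)) = u ⊗ v ⊗ w.
Proof.
have B (u' : U) : bilinear_for *:%R *:%R
    (fun (v' : V) (w' : W) => u' ⊗ v' ⊗ w' : tensor (tensor U V) W).
  split=> ? z ? ?; last by rewrite tenDr tenZr.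
  by rewrite tenDr tenZr tenDl tenZl.
rewrite /tassoc tlift_ten; first by rewrite tlift_ten.
(* Linearity in the left factor for a fixed [X] is not formal: it is reduced to pure tensors [X]. *)
split=> [X | x] z y y'; last by rewrite linearP.
elim/ten_ind: X => [v' w'|X X' eX eX'].
  by rewrite !tlift_ten // !(tenDl, tenZl).
by rewrite !linearD /= eX eX' scalerDr addrACA.
Qed.

Lemma ten1_tunitl V (X : tensor k^o V) : (1 : k^o) ⊗ tunitl X = X.
Proof.
elim/ten_ind: X => [t v|X Y eX eY]; last by rewrite linearD tenDr eX eY.
by rewrite tunitl_ten tenZr -tenZl [_ *: _]mulr1.
Qed.

(** The map id ⊗ f followed by the identification of U ⊗ k with U, that is, contraction of the right
    factor. *)
Definition tslice U V (f : {scalar V}) : tensor U V -> U :=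
  tlift (fun u v => f v *: u).

HB.instance Definition _ U V (f : {scalar V}) :=
  GRing.Linear.copy (@tslice U V f) (tlift (fun u v => f v *: u)).

Lemma tslice_ten U V (f : {scalar V}) (u : U) (v : V) :
  tslice f (u ⊗ v) = f v *: u.
Proof.
rewrite /tslice tlift_ten //; split=> x z y y'; first exact: scale_rightP.
by rewrite linearP /= scale_leftP.
Qed.

End TensorMapTheory.

(** * Partial coactions on the base field as elements of the Hopf algebra *)

Section CoactionOnBaseField.
Variables (k : fieldType) (H : falgType k) (hH : hopfAlg H).

Lemma mul_ten1_tassoc (e : H) (X : tensor H H) :
  ((1 : k^o) ⊗ e ⊗ (1 : H)) * tassoc ((1 : k^o) ⊗ X)
    = tassoc ((1 : k^o) ⊗ ((e ⊗ (1 : H)) * X)).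
Proof.
elim/ten_ind: X => [u v|X Y eX eY].
  by rewrite !(tassoc_ten, mul_ten) !mul1r.
by rewrite mulrDr !tenDr !linearD mulrDr eX eY.
Qed.

(** Collapsing the factor [k^o] with [tunitl] is a left inverse. Hence axiom (iii), an identity in k
    ⊗ H ⊗ H, can be read in H ⊗ H. *)
Lemma tassoc_ten1_inj : injective (fun X : tensor H H => tassoc ((1 : k^o) ⊗ X)).
Proof.
apply: (@can_inj _ _ _ (tmap (@tunitl k H) idfun)); elim/ten_ind=> [u v|X Y eX eY].
  by rewrite tassoc_ten tmap_ten /= tunitl_ten scale1r.
by rewrite tenDr !linearD /= eX eY.
Qed.

Lemma tensor_counit_idempotent (e : H) : counit hH e = 1 ->
  (e ⊗ (1 : H)) * comul hH e = e ⊗ e -> e * e = e.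
Proof.
move=> e1 ee.
(* id ⊗ eps commutes with left multiplication by e, so it sends the left side of [ee] to e * e and
   the right side to eps(e) e. *)
have counit_mul X : tunitr (tmap id (counit hH) ((e ⊗ (1 : H)) * X))
    = e * tunitr (tmap id (counit hH) X).
  elim/ten_ind: X => [u v|X Y eX eY]; last by rewrite !(mulrDr, linearD) /= eX eY.
  by rewrite mul_ten !(tmap_ten idfun) !tunitr_ten mul1r scalerAr.
rewrite -{2}(counitr hH e) -counit_mul ee (tmap_ten idfun) tunitr_ten e1.
exact: scale1r.
Qed.

Lemma partial_coaction_baseP (rho : k^o -> tensor k^o H) :
  partial_coaction hH rho <->
  exists e : H, (forall t : k, rho t = t *: ((1 : k^o) ⊗ e)) /\
    (counit hH e = 1 /\ (e ⊗ (1 : H)) * comul hH e = e ⊗ e).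
Proof.
split=> [[rhoL rho_counit _ rhoA] | [e [rhoE [e1 ee]]]].
- pose R : {linear k^o -> tensor k^o H} :=
    HB.pack rho (GRing.isLinear.Build _ _ _ _ _ rhoL).
  pose e := tunitl (rho 1); have rho1 : rho 1 = 1 ⊗ e by rewrite ten1_tunitl.
  exists e; split=> [t|].
    by rewrite -rho1 -[rho 1]/(R 1) -linearZ [_ *: _]mulr1.
  split.
    by have := rho_counit 1; rewrite rho1 (tmap_ten idfun) tunitr_ten [_ *: _]mulr1.
  apply: tassoc_ten1_inj; rewrite -mul_ten1_tassoc tassoc_ten.
  have := rhoA 1; rewrite rho1 (tmap_ten idfun) (tmap_ten R idfun) /= rho1.
  by move->.
- have rhoL : linear rho by move=> z x y; rewrite !rhoE scalerDl scalerA.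
  pose R : {linear k^o -> tensor k^o H} :=
    HB.pack rho (GRing.isLinear.Build _ _ _ _ _ rhoL).
  have rho1 : rho 1 = 1 ⊗ e by rewrite rhoE scale1r.
  split=> // [t|s t|t].
  + rewrite rhoE -tenZr (tmap_ten idfun) tunitr_ten linearZ e1.
    by rewrite -[RHS]mulr1 [_ *: 1]mulr1 [LHS]mulr1 mulr1.
  (* Multiplicativity of [rho] is the idempotence of e. *)
  + rewrite !rhoE -scalerAl -scalerAr scalerA mul_ten mul1r.
    by rewrite (tensor_counit_idempotent e1 ee).
  + rewrite rho1 rhoE -tenZr (tmap_ten idfun) (tmap_ten R idfun) /= rho1.
    by rewrite mul_ten1_tassoc linearZ -scalerAr ee -tenZr tassoc_ten.
Qed.

End CoactionOnBaseField.

(** Contracting with the j-th coordinate functional of the free family isolates the left coefficient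
    of its j-th vector. *)
Lemma ten_free_inj (k : fieldType) (U V : vectType k) n (B : n.-tuple V)
    (u w : 'I_n -> U) : free B ->
  \sum_i u i ⊗ B`_i = \sum_i w i ⊗ B`_i -> u =1 w.
Proof.
move=> freeB eq_uw j.
suff slice (x : 'I_n -> U) : tslice (coord B j) (\sum_i x i ⊗ B`_i) = x j.
  by rewrite -slice eq_uw slice.
rewrite linear_sum (bigD1 j) //= tslice_ten /= coord_free // eqxx scale1r.
rewrite big1 ?addr0 // => i /negPf ij.
by rewrite tslice_ten /= coord_free // ij scale0r.
Qed.

(** * Coordinates, multiplication and the coaction equation in K *)

Section K8.
Variables (k : fieldType) (q : k) (K : falgType k) (hK : hopfAlg K).
Variables (a b c d : K) (K8 : isK8 q hK a b c d) (qq : q * q = -1).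

Definition K8_elt (x1 xa xb xc xd xaa xab xac : k) : K :=
  x1 *: 1 + xa *: a + xb *: b + xc *: c + xd *: d + xaa *: a ^+ 2
  + xab *: (a * b) + xac *: (a * c).

Let B : 8.-tuple K := [tuple 1; a; b; c; d; a ^+ 2; a * b; a * c].

Let freeB : free B. Proof. exact: basis_free (K8_basis K8). Qed.

Lemma K8_eltP e : exists x1 xa xb xc xd xaa xab xac,
  e = K8_elt x1 xa xb xc xd xaa xab xac.
Proof.
have := @coord_basis _ _ _ _ B e (K8_basis K8) (memvf e).
by rewrite !big_ord_recl big_ord0 addr0 !addrA => eB; do 8!eexists; apply: eB.
Qed.

Lemma K8_elt_inj x1 xa xb xc xd xaa xab xac y1 ya yb yc yd yaa yab yac :
  K8_elt x1 xa xb xc xd xaa xab xac = K8_elt y1 ya yb yc yd yaa yab yac ->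
  [:: x1; xa; xb; xc; xd; xaa; xab; xac] = [:: y1; ya; yb; yc; yd; yaa; yab; yac].
Proof.
set s := [:: x1; _; _; _; _; _; _; _]; set t := [:: y1; _; _; _; _; _; _; _].
have eltE (r : seq k) : K8_elt r`_0 r`_1 r`_2 r`_3 r`_4 r`_5 r`_6 r`_7
    = \sum_(i < 8) r`_i *: B`_i.
  by rewrite !big_ord_recl big_ord0 addr0 !addrA.
move=> eq_st; apply: (eq_from_nth (x0 := 0)) => // i lti.
rewrite -(coord_sum_free (fun i : 'I_8 => s`_i) (Ordinal lti) freeB).
rewrite -(coord_sum_free (fun i : 'I_8 => t`_i) (Ordinal lti) freeB).
by rewrite -!eltE; congr coord.
Qed.

Lemma K8_elt1 : K8_elt 1 0 0 0 0 0 0 0 = 1.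
Proof. by rewrite /K8_elt !scale0r !addr0 scale1r. Qed.

Lemma K8_eltD x1 xa xb xc xd xaa xab xac y1 ya yb yc yd yaa yab yac :
  K8_elt x1 xa xb xc xd xaa xab xac + K8_elt y1 ya yb yc yd yaa yab yac
    = K8_elt (x1 + y1) (xa + ya) (xb + yb) (xc + yc) (xd + yd) (xaa + yaa)
        (xab + yab) (xac + yac).
Proof.
apply: scalar_ext => f; rewrite /K8_elt.
rewrite !(linearD, linearZ) /=; ring.
Qed.

Lemma K8_eltZ z x1 xa xb xc xd xaa xab xac :
  z *: K8_elt x1 xa xb xc xd xaa xab xac
    = K8_elt (z * x1) (z * xa) (z * xb) (z * xc) (z * xd) (z * xaa)
        (z * xab) (z * xac).
Proof. by rewrite /K8_elt !scalerDr !scalerA. Qed.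

Let aaaa x : a * (a * (a * (a * x))) = x.
Proof. by rewrite -[RHS]mul1r -(K8_a4 K8) !exprS mulr1 -!mulrA. Qed.

Let aaa : a * (a * a) = d.
Proof. by rewrite -[LHS](mulr1) -(K8_ad K8) -!mulrA aaaa. Qed.

Let bE : b = a * (a * c). Proof. by rewrite -(K8_aac K8) mulrA. Qed.

Let ca : c * a = - q *: (a * c).
Proof. by rewrite (K8_ac K8) scalerA mulNr qq opprK scale1r. Qed.

Let caw x : c * (a * x) = - q *: (a * (c * x)).
Proof. by rewrite mulrA ca -scalerAl -mulrA. Qed.

Let cc : c * c = 0. Proof. exact: K8_cc K8. Qed.

Let aaaa1 : a * (a * (a * a)) = 1. Proof. by rewrite -[RHS](aaaa 1) mulr1. Qed.

(** As d = a^3 and b = a^2 c, everything is a word in a and c. Since q^-1 = -q, each c moves right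
    past a at the cost of -q. Products are nested to the right, so the rules with a tail [x] handle
    the inside of a word. *)
Let K8_word := (bE, =^~ aaa, aaaa1, aaaa, ca, caw, cc).

Let normE := (mulrDl, =^~ scalerAl, =^~ scalerAr, =^~ mulrA, mul1r, mulr1, mulr0,
  scaler0).

(* Both sides are rewritten as combinations of the words a^i and a^i c with i < 4. *)
Local Ltac K8_normalize := apply: scalar_ext => f; rewrite /K8_elt expr2;
  rewrite !(K8_word, normE) !(linearD, linearZ, linear0) /=; ring: qq.

(** Each basis vector sends monomials to multiples of monomials or to zero, so right multiplication
    permutes coordinates up to scalars; a factor containing c kills the nilpotent coordinates, as
    c^2 = 0. *)
Lemma K8_elt_mula x1 xa xb xc xd xaa xab xac :
  K8_elt x1 xa xb xc xd xaa xab xac * a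
    = K8_elt xd x1 (- q * xac) (- q * xab) xaa xa (- q * xb) (- q * xc).
Proof. K8_normalize. Qed.

Lemma K8_elt_mulaa x1 xa xb xc xd xaa xab xac :
  K8_elt x1 xa xb xc xd xaa xab xac * a ^+ 2
    = K8_elt xaa xd (- xc) (- xb) xa x1 (- xac) (- xab).
Proof. K8_normalize. Qed.

Lemma K8_elt_muld x1 xa xb xc xd xaa xab xac :
  K8_elt x1 xa xb xc xd xaa xab xac * d
    = K8_elt xa xaa (q * xab) (q * xac) x1 xd (q * xc) (q * xb).
Proof. K8_normalize. Qed.

Lemma K8_elt_mulb x1 xa xb xc xd xaa xab xac :
  K8_elt x1 xa xb xc xd xaa xab xac * b
    = K8_elt 0 0 x1 xaa 0 0 xa xd.
Proof. K8_normalize. Qed.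

Lemma K8_elt_mulc x1 xa xb xc xd xaa xab xac :
  K8_elt x1 xa xb xc xd xaa xab xac * c
    = K8_elt 0 0 xaa x1 0 0 xd xa.
Proof. K8_normalize. Qed.

Lemma K8_elt_mulab x1 xa xb xc xd xaa xab xac :
  K8_elt x1 xa xb xc xd xaa xab xac * (a * b)
    = K8_elt 0 0 xd xa 0 0 x1 xaa.
Proof. K8_normalize. Qed.

Lemma K8_elt_mulac x1 xa xb xc xd xaa xab xac :
  K8_elt x1 xa xb xc xd xaa xab xac * (a * c)
    = K8_elt 0 0 xa xd 0 0 xaa x1.
Proof. K8_normalize. Qed.

Definition K8_elt_mul := (K8_elt_mula, K8_elt_mulaa, K8_elt_muld, K8_elt_mulb,
  K8_elt_mulc, K8_elt_mulab, K8_elt_mulac).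

(** The i-th entries of the two lists are the left coefficients of the i-th basis vector in the
    right tensor factor. Keeping [h] apart from the coordinates leaves its products with the basis
    to the tables above. *)
Lemma K8_comul_rowsP (h : K) x1 xa xb xc xd xaa xab xac :
  (h ⊗ (1 : K)) * comul hK (K8_elt x1 xa xb xc xd xaa xab xac)
    = h ⊗ K8_elt x1 xa xb xc xd xaa xab xac <->
  [:: x1 *: h + xab *: (h * (a * b)); xa *: (h * a) + xc *: (h * c);
      xb *: (h * a) + xd *: (h * c); xa *: (h * b) + xc *: (h * d);
      xd *: (h * d) + xb *: (h * b); xaa *: (h * a ^+ 2) + xac *: (h * (a * c));
      xab *: (h * a ^+ 2); xac *: h]
    = [:: x1 *: h; xa *: h; xb *: h; xc *: h; xd *: h; xaa *: h; xab *: h; xac *: h].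
Proof.
set L := (X in X = _ <-> _); set R := (X in _ = X <-> _).
set ls := (X in _ <-> X = _); set rs := (X in _ <-> _ = X).
have eqL : L = \sum_(i < 8) ls`_i ⊗ B`_i.
  rewrite /L /K8_elt !linearD !linearZ /= (K8_comul1 K8) (K8_comula K8).
  rewrite (K8_comulb K8) (K8_comulc K8) (K8_comuld K8) (K8_comulaa K8).
  rewrite (K8_comulab K8) (K8_comulac K8).
  rewrite !(mulrDr, =^~ scalerAr, mul_ten, mul1r, mulr1).
  rewrite !big_ord_recl big_ord0 addr0 /=.
  apply: scalar_ext => f; rewrite !(tenDl, tenZl, linearD, linearZ) /=; ring.
have eqR : R = \sum_(i < 8) rs`_i ⊗ B`_i.
  rewrite /R /K8_elt !big_ord_recl big_ord0 addr0 /= !addrA.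
  by rewrite !(tenDr, tenZr, tenZl).
split=> [eqLR | eq_s]; last by rewrite eqL eqR eq_s.
apply: (eq_from_nth (x0 := 0)) => // i lti.
have := @ten_free_inj _ _ _ _ B (fun i => ls`_i) (fun i => rs`_i) freeB.
by rewrite -eqL -eqR => /(_ eqLR (Ordinal lti)).
Qed.

(** * Solutions of the coaction equation and their classification *)

Lemma K8_counit x1 xa xb xc xd xaa xab xac :
  counit hK (K8_elt x1 xa xb xc xd xaa xab xac) = x1 + xa + xd + xaa.
Proof.
rewrite /K8_elt !linearD !linearZ /= (K8_counit1 K8) (K8_counita K8).
rewrite (K8_counitb K8) (K8_counitc K8) (K8_counitd K8) (K8_counitaa K8).
rewrite (K8_counitab K8) (K8_counitac K8) !scaler0 !addr0.
by rewrite ![_ *: 1]mulr1.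
Qed.

(** The equation is homogeneous of degree two in e, so the scale [t] stays free; only the counit
    condition will fix it. *)
Lemma K8_solve_full (t y : k) : y * y = - (q * t * t) ->
  let e := K8_elt t t y (q * y) t t 0 ((1 + q) * y) in
  (e ⊗ (1 : K)) * comul hK e = e ⊗ e.
Proof.
move=> yy e; apply/K8_comul_rowsP; rewrite /e !K8_elt_mul !K8_eltZ !K8_eltD.
congr [:: _; _; _; _; _; _; _; _]; congr K8_elt; ring: qq yy.
Qed.

Lemma K8_solve_half (t y : k) :
  let e := K8_elt t 0 0 0 0 t 0 y in
  (e ⊗ (1 : K)) * comul hK e = e ⊗ e.
Proof.
move=> e; apply/K8_comul_rowsP; rewrite /e !K8_elt_mul !K8_eltZ !K8_eltD.
congr [:: _; _; _; _; _; _; _; _]; congr K8_elt; ring: qq.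
Qed.

(** Certificate form: [x = y] follows from a known equation once [x - y] is exhibited as a multiple
    of its difference, which [ring] checks. *)
Let eq_comb (z l r x y : k) : l = r -> x - y = z * (l - r) -> x = y.
Proof. by move=> -> xy; apply: subr0_eq; rewrite xy subrr mulr0. Qed.

(** When 1, a, a^2, d all have coefficient [t], these equations, taken from the rows of 1, a and b,
    make [xb] determine the nilpotent part and fix its square. *)
Let quarter_coefs (t xb xc xab xac : k) : t != 0 ->
    t * xab + xab * t = t * xab -> t * (- q * xb) + xc * t = t * xab ->
    t * (- q * xc) + xc * t = t * xac -> xb * (- q * xac) + t * t = xb * xb ->
  [/\ xab = 0, xc = q * xb, xac = (1 + q) * xb & xb * xb = - (q * t * t)].
Proof.
move=> t0 r1 r2 r3 r4.
have xab0 : xab = 0 by apply: (mulfI t0); apply: (eq_comb (z := 1) r1); ring.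
have xcE : xc = q * xb.
  by apply: (mulfI t0); apply: (eq_comb (z := 1) r2); rewrite xab0; ring.
have xacE : xac = (1 + q) * xb.
  apply: (mulfI t0); apply: (eq_comb (z := -1) r3); rewrite xcE; ring: qq.
by split=> //; apply: (eq_comb (z := q) r4); rewrite xacE; ring: qq.
Qed.

Lemma K8_classification (e : K) : 2 != 0 :> k -> counit hK e = 1 ->
  (e ⊗ (1 : K)) * comul hK e = e ⊗ e ->
  [\/ e = 1, exists y, e = K8_elt 2^-1 0 0 0 0 2^-1 0 y
    | exists2 y : k, y * y = - (q * 4^-1 * 4^-1)
      & e = K8_elt 4^-1 4^-1 y (q * y) 4^-1 4^-1 0 ((1 + q) * y)].
Proof.
move=> two_neq0.
have [x1 [xa [xb [xc [xd [xaa [xab [xac ->]]]]]]]] := K8_eltP e.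
rewrite K8_counit => sum1 /K8_comul_rowsP; rewrite !K8_elt_mul !K8_eltZ !K8_eltD.
case=> /K8_elt_inj[_ _ _ _ _ _ r1_ab _].
case/K8_elt_inj=> ra_1 ra_a ra_b ra_c _ ra_aa ra_ab ra_ac.
case/K8_elt_inj=> _ _ rb_b _ _ _ _ _ _.
case/K8_elt_inj=> rd_1 _ rd_b _ rd_d _ _ _.
case/K8_elt_inj=> raa_1 _ _ _ _ _ _ raa_ac _.
have four_neq0 : 4 != 0 :> k by rewrite (_ : 4 = 2 * 2) ?mulf_neq0 // -natrM.
have case3 : x1 = xa -> xd = xa -> xaa = xa ->
  exists2 y : k, y * y = - (q * 4^-1 * 4^-1)
    & K8_elt x1 xa xb xc xd xaa xab xac
      = K8_elt 4^-1 4^-1 y (q * y) 4^-1 4^-1 0 ((1 + q) * y).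
  move=> e1 ed eaa; subst x1 xd xaa.
  have xaE : xa = 4^-1.
    by apply: (mulfI four_neq0); rewrite divff // -[RHS]sum1; ring.
  subst xa.
  have [-> -> -> yy] := quarter_coefs (invr_neq0 four_neq0) r1_ab ra_ab ra_ac rb_b.
  by exists xb.
(* If [xa] is nonzero, the row of a says that e * a agrees with e modulo the nilpotent monomials, so
   the coefficients are constant on the powers of a. *)
have [xa0|xa_neq0] := eqVneq xa 0; last first.
  have x1E : x1 = xa.
    by apply: (mulfI xa_neq0); apply: (eq_comb (z := 1) ra_a); ring.
  constructor 3; apply: case3 => //; apply: (mulfI xa_neq0).
    by apply: (eq_comb (z := 1) ra_1); rewrite x1E; ring.
  by apply: (eq_comb (z := -1) ra_aa); ring.
(* With [xa = 0], the row of d gives [xd * x1 = 0] at coordinate 1 and [xd * x1 = xd * xd] at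
   coordinate d. *)
subst xa; have xd0 : xd = 0.
  apply/eqP; rewrite -[_ == 0]orbb -mulf_eq0; apply/eqP.
  transitivity (xd * x1); first by apply: (eq_comb (z := -1) rd_d); ring.
  by apply: (eq_comb (z := -1) rd_1); ring.
(* Only 1 and a^2 are left: [xaa] decides between the trivial subgroup and the one generated by
   a^2. *)
subst xd; have [xaa0|xaa_neq0] := eqVneq xaa 0.
  subst xaa; have x1E : x1 = 1 by rewrite -sum1; ring.
  subst x1; have xab0 : xab = 0 by apply: (eq_comb (z := 1) r1_ab); ring.
  have xc0 : xc = 0 by apply: (eq_comb (z := 1) ra_c); ring.
  have xb0 : xb = 0 by apply: (eq_comb (z := 1) rd_b); ring.
  have xac0 : xac = 0 by apply: (eq_comb (z := 1) raa_ac); rewrite xab0; ring.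
  by constructor 1; rewrite xb0 xc0 xab0 xac0 K8_elt1.
have x1E : x1 = xaa.
  by apply: (mulfI xaa_neq0); apply: (eq_comb (z := -1) raa_1); ring.
subst x1; have xaaE : xaa = 2^-1.
  by apply: (mulfI two_neq0); rewrite divff // -[RHS]sum1; ring.
have xab0 : xab = 0.
  by apply: (mulfI xaa_neq0); apply: (eq_comb (z := 1) r1_ab); ring.
have xc0 : xc = 0.
  by apply: (mulfI xaa_neq0); apply: (eq_comb (z := 1) ra_b); ring.
have xb0 : xb = 0.
  by apply: (mulfI xaa_neq0); apply: (eq_comb (z := 1) rd_b); rewrite xab0; ring.
(* The coefficient of ac is unconstrained and becomes the parameter of the family. *)
by constructor 2; exists xac; rewrite xb0 xc0 xab0 -xaaE.
Qed.

(** * The families of the theorem in coordinates *)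

Lemma K8_elt_half (t y : k) :
  t *: (1 + a ^+ 2) + y *: (a * c) = K8_elt t 0 0 0 0 t 0 y.
Proof. by rewrite /K8_elt !scale0r !addr0 scalerDr. Qed.

(** The substitution y = (1 + q) w links the two forms, since q (1 + q) = -(1 - q) and (1 + q)^2 =
    2q. *)
Lemma K8_elt_full (t w : k) :
  t *: (1 + a + a ^+ 2 + d)
    + w *: ((1 + q) *: b - (1 - q) *: c + (2 * q) *: (a * c))
  = K8_elt t t ((1 + q) * w) (q * ((1 + q) * w)) t t 0 ((1 + q) * ((1 + q) * w)).
Proof.
apply: scalar_ext => f; rewrite /K8_elt !(linearD, linearN, linearZ) /=; ring: qq.
Qed.

End K8.

Theorem mainTheorem6 (k : closedFieldType) (char0 : [pchar k] =i pred0)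
    (xi : k) (xi8 : 8.-primitive_root xi) (K : falgType k) (hK : hopfAlg K)
    (a b c d : K) (K8 : isK8 (xi ^+ 2) hK a b c d)
    (rho : k^o -> tensor k^o K) :
  let q := xi ^+ 2 in
  let sqrt2 := 2 * xi / (1 + xi ^+ 2) in
  partial_coaction hK rho <->
  exists e : K,
    (forall t : k, rho t = t *: ((1 : k^o) ⊗ e)) /\
    [\/ e = 1,
        exists alpha : k,
          e = 2^-1 *: (1 + a ^+ 2) + (alpha * q * (sqrt2 / 2)) *: (a * c)
      | exists zeta : k, (zeta = q \/ zeta = - q) /\
          e = 4^-1 *: (1 + a + a ^+ 2 + d)
              + (zeta * (sqrt2 / 8))
                *: ((1 + q) *: b - (1 - q) *: c + (2 * q) *: (a * c))].
Proof.
move=> q sqrt2; rewrite -/q in K8.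
have two_neq0 : 2 != 0 :> k by rewrite (pcharf0P k).1.
(* q^2 = xi^4 squares to 1 but differs from 1 by primitivity. *)
have q2 : q ^+ 2 = -1.
  have : xi ^+ 8 = 1 by exact: prim_expr_order.
  have : xi ^+ 4 != 1 by rewrite -(prim_order_dvd xi8).
  rewrite -[8%N]/(4 * 2)%N exprM => + /eqP; rewrite -subr_eq0 => n1.
  rewrite sqrf_eq1 -subr_eq0 (negPf n1) /= => /eqP <-.
  by rewrite -exprM.
have qq : q * q = -1 by rewrite -expr2.
have q0 : q != 0.
  by apply: contraTneq (oner_neq0 k) => q0; rewrite -oppr_eq0 -qq q0 mul0r eqxx.
have q1 : 1 + q != 0.
  apply: contraNneq two_neq0 => /eqP; rewrite addrC addr_eq0 => /eqP qE.
  by rewrite -[2]/(1 + 1) -{1}[1]opprK -qq qE mulrNN mulr1 addNr.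
(* Both sides times (1 + q)^2 = 2q give 4q. *)
have ss : sqrt2 * sqrt2 = 2.
  rewrite /sqrt2 -/q; apply: (mulfI (mulf_neq0 q1 q1)).
  transitivity (4 * q); last by ring: qq.
  by rewrite /q in q1 *; field.
have s0 : sqrt2 != 0 by apply: contraNneq two_neq0 => s0; rewrite -ss s0 mul0r.
have nz n : n.+1%:R != 0 :> k by rewrite (pcharf0P k).1.
(* From here on q and [sqrt2] enter only through q^2 = -1, [ss] and the nonvanishing facts. *)
clearbody sqrt2; clearbody q.
apply: (iff_trans (partial_coaction_baseP hK rho)).
split=> [[e [rhoE [e1 ee]]] | [e [rhoE eE]]]; exists e; split=> //.
  have [|[y ->]|[y yy ->]] := K8_classification K8 qq two_neq0 e1 ee.
  - by constructor 1.
  - constructor 2; exists (y / (q * (sqrt2 / 2))).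
    rewrite -K8_elt_half -mulrA divfK //.
    by rewrite !mulf_neq0 ?invr_eq0.
  - pose w := y / (1 + q); have yE : y = (1 + q) * w by rewrite mulrC divfK.
    (* From y^2 = -q/16 and y^2 = 2q w^2. *)
    have ww : 32 * (w * w) = -1.
      apply: (mulfI q0); transitivity (16 * (y * y)); first by rewrite yE; ring: qq.
      by rewrite yy; field; rewrite ?s0 ?nz.
    have zE : 8 * w / sqrt2 * (sqrt2 / 8) = w by field; rewrite ?s0 ?nz.
    (* This zeta solves zeta * sqrt2 / 8 = w; its square is 32 w^2 = -1 = q^2, so it is q or -q. *)
    constructor 3; exists (8 * w / sqrt2); split.
      apply/pred2P; rewrite -eqf_sqr q2 -ww; apply/eqP.
      transitivity (64 * (w * w) / (sqrt2 * sqrt2)); first by field; rewrite ?s0 ?nz.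
      by rewrite ss; field; rewrite ?s0 ?nz.
    by rewrite zE K8_elt_full // -yE.
case: eE => [->|[alpha ->]|[zeta [zetaE ->]]].
- by rewrite (counit1 hK) (comul1 hK) mulr1.
- rewrite (K8_elt_half a b c d); split; last exact: (K8_solve_half K8 qq).
  by rewrite (K8_counit K8); field; rewrite ?s0 ?nz.
- rewrite K8_elt_full //; split.
    by rewrite (K8_counit K8); field; rewrite ?s0 ?nz.
  have zz : zeta * zeta = -1 by case: zetaE => ->; rewrite ?mulrNN.
  have ww : zeta * (sqrt2 / 8) * (zeta * (sqrt2 / 8)) = - 32^-1.
    transitivity ((zeta * zeta) * (sqrt2 * sqrt2) / 64); first by field; rewrite ?s0 ?nz.
    by rewrite zz ss; field; rewrite ?s0 ?nz.
  (* The required condition at t = 1/4 is 2q w^2 = -q/16, which holds as w^2 = -1/32. *)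
  apply: (K8_solve_full K8 qq); set w := zeta * _ in ww *.
  transitivity (2 * q * (w * w)); first by ring: qq.
  by rewrite ww; field; rewrite ?s0 ?nz.
Qed.
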